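(* Call a positive integer $n$ bad if there exist $f_1,\dots,f_n,r_1,\dots,r_n\in\mathbb{F}_2[x]$ with $\deg(r_i)<\deg(f_i)$ for all $i$ such that some polynomial $g\in\mathbb{F}_2[x]$ satisfies none of the congruences $g\equiv r_i\pmod{f_i}$ ($1\le i\le n$), while every polynomial $g_0\in\mathbb{F}_2[x]$ with $\deg(g_0)<n$ satisfies at least one of them. If some positive integer is bad, then some positive integer $n<10$ is bad.
   Context: Convention: the zero polynomial is regarded as having degree $0$. A polynomial $g$ satisfies $g\equiv r\pmod f$ if $f\mid(g-r)$. *)

(* Defs.v *)
From HB Require Import structures.
From mathcomp Require Import all_boot all_order all_algebra.

Set Implicit Arguments.
Unset Strict Implicit.
Unset Printing Implicit Defensive.

Import GRing.Theory.
Local Open Scope ring_scope.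

(* The zero polynomial has degree 0: size 0 = 0 and 0.-1 = 0. *)
Definition pdeg (R : nzRingType) (p : {poly R}) : nat := (size p).-1.

Definition pcong (F : fieldType) (g r f : {poly F}) : Prop := f %| (g - r).

Definition bad (n : nat) : Prop :=
  (0 < n)%N /\
  exists f r : 'I_n -> {poly 'F_2},
    [/\ forall i, (pdeg (r i) < pdeg (f i))%N,
        exists g : {poly 'F_2}, forall i, ~ pcong g (r i) (f i)
      & forall g0 : {poly 'F_2}, (pdeg g0 < n)%N ->
          exists i, pcong g0 (r i) (f i)].

(* Main.v *)
Require Import Defs.
From HB Require Import structures.
From mathcomp Require Import all_boot all_order all_algebra all_field.
From mathcomp Require Import zify ring.

(** In fact no [n] is bad: if [n] congruences over [F_2[x]] miss some polynomial
    [g], they miss one of degree less than [n].  This goes by strong induction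
    on [n].

    Each modulus may be replaced by a prime power [p^k] dividing it that still
    separates [g] from the residue.  Suppose that at least [d = deg p] of the
    moduli are powers of one prime [p].  Then some class [a] mod [p] that is not
    entirely covered is disjoint from at least [d] of the congruences: either
    the class of [g], or a class hit by no residue of a power of [p] (which
    contains a missed polynomial, the other moduli being prime to [p]).
    Substituting [g = p h + a] leaves at most [n - d] congruences on [h], to
    which the induction hypothesis applies.

    Otherwise each prime [p] carries at most [deg p - 1] congruences.  Put
    [D = floor(log_2 n)] and let [S] consist of the primes of degree less than
    [D] that occur and of about [(n - 2^D) / D] of those of degree [D].  By the
    Chinese remainder theorem there is a class mod [Q = prod S] missed by all
    congruences at [S]; inside it, the union bound over the remaining ones leaves
    a polynomial of degree less than [n] uncovered.  The numerical input is
    [d * pi(d) + 2 <= 2^d] for [d >= 2], where [pi(d)] counts the irreducible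
    polynomials of degree [d]. *)

Set Implicit Arguments.
Unset Strict Implicit.
Unset Printing Implicit Defensive.

Import GRing.Theory.
Local Open Scope ring_scope.

(** * Degrees and monic irreducible polynomials over a finite field *)

Lemma pdegM (R : idomainType) (p q : {poly R}) :
  p != 0 -> q != 0 -> pdeg (p * q) = (pdeg p + pdeg q)%N.
Proof.
move=> p0 q0; rewrite /pdeg size_mul //.
by move: p0 q0; rewrite -!size_poly_gt0; move: (size p) (size q); lia.
Qed.

Section MonicIrreducible.

Variable F : finFieldType.
Implicit Types (p q f g h s a : {poly F}).

Definition monic_irr p := irreducibleb p && (p \is monic).

Lemma monic_irr_neq0 p : monic_irr p -> p != 0.
Proof. by case/andP=> _ /monic_neq0. Qed.

Lemma monic_irr_pdeg_gt0 p : monic_irr p -> (0 < pdeg p)%N.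
Proof. by case/andP=> /irreducibleP [sp _] _; rewrite /pdeg -subn1 subn_gt0. Qed.

Lemma size_monic_irr p : monic_irr p -> size p = (pdeg p).+1.
Proof. by move/monic_irr_neq0=> p0; rewrite /pdeg prednK // size_poly_gt0. Qed.

Lemma coprimep_monic_irr p f : monic_irr p -> coprimep p f = ~~ (p %| f).
Proof. by case/andP=> /irreducibleP /irreducible_poly_coprime. Qed.

Lemma dvdp_monic_irr p q : monic_irr p -> monic_irr q -> (p %| q) = (p == q).
Proof.
move=> Pp Pq; apply/idP/eqP=> [pq|->]; last exact: dvdpp.
case/andP: Pq => /irreducibleP [_ /(_ p)] H mq.
have sp : size p != 1 by rewrite size_monic_irr //; have := monic_irr_pdeg_gt0 Pp; lia.
by apply/eqP; rewrite -eqp_monic ?(H sp pq) //; case/andP: Pp.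
Qed.

Lemma monic_irr_coprimep_neq p q :
  monic_irr p -> monic_irr q -> coprimep p q = (p != q).
Proof. by move=> Pp Pq; rewrite coprimep_monic_irr // dvdp_monic_irr. Qed.

Lemma monic_irr_dvd f : (1 < size f)%N -> exists2 p, monic_irr p & p %| f.
Proof.
have [m] := ubnP (size f); elim: m f => // m IH f lefm f_gt1.
have [irr|] := boolP (irreducibleb f).
  have lf0 : lead_coef f != 0 by rewrite lead_coef_eq0 -size_poly_eq0; lia.
  have eqf : (lead_coef f)^-1 *: f %= f by rewrite eqp_scale ?invr_eq0.
  exists ((lead_coef f)^-1 *: f); last by rewrite (eqp_dvdl _ eqf).
  rewrite /monic_irr monicE lead_coefZ mulVf // eqxx andbT.
  case/irreducibleP: irr => sf irr; apply/irreducibleP; split.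
    by rewrite (eqp_size eqf).
  move=> q sq; rewrite (eqp_dvdr _ eqf) => /(irr q sq) eqq.
  by apply: (eqp_trans eqq); rewrite eqp_sym.
(* Failure of [irreducibleb] supplies a nonconstant divisor of size at most [(size f).-1], to which
   the induction applies. *)
rewrite /irreducibleb f_gt1 /= negb_forall => /existsP /= [q].
rewrite negb_imply -Pdiv.Idomain.dvdpE -ltnNge => /andP [qf q_gt1].
have [|p Pp pq] := IH (val q) _ q_gt1.
  by apply: leq_ltn_trans (size_npoly q) _; rewrite -ltnS prednK // ltnW.
by exists p => //; apply: dvdp_trans qf.
Qed.

Lemma monic_irr_multiplicity p f : monic_irr p -> f != 0 ->
  exists k u, f = u * p ^+ k /\ ~~ (p %| u).
Proof.
move=> Pp; have p_gt0 := monic_irr_pdeg_gt0 Pp; have sp := size_monic_irr Pp.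
have [m] := ubnP (size f); elim: m f => // m IH f lefm f0.
have [pf|Npf] := boolP (p %| f); last by exists 0, f; rewrite mulr1.
have [||k [u [Df Npu]]] := IH (f %/ p).
- rewrite size_divp ?monic_irr_neq0 // sp /=; move: f0 lefm; rewrite -size_poly_gt0.
  by move: (size f); lia.
- by rewrite dvdp_div_eq0.
by exists k.+1, u; rewrite exprSr mulrA -Df divpK.
Qed.

(** Split off from [f] the full power of one prime. If that power divides [s], the coprime cofactor
    cannot divide [s], and the induction passes to it. *)
Lemma prime_power_separates f s : f != 0 -> ~~ (f %| s) ->
  exists p k, [/\ monic_irr p, p ^+ k %| f & ~~ (p ^+ k %| s)].
Proof.
have [m] := ubnP (size f); elim: m f => // m IH f lefm f0 Nfs.
have f_gt1 : (1 < size f)%N.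
  rewrite ltnNge; apply: contra Nfs => sf.
  have : size f == 1 by move: f0; rewrite -size_poly_eq0; lia.
  by rewrite size_poly_eq1 => /eqp_dvdl ->; rewrite dvd1p.
have [p Pp pf] := monic_irr_dvd f_gt1.
have [k [u [Df Npu]]] := monic_irr_multiplicity Pp f0.
have [pks|] := boolP (p ^+ k %| s); last by exists p, k; rewrite Df dvdp_mull.
have cop : coprimep u (p ^+ k).
  by rewrite coprimep_sym coprimep_expl // coprimep_monic_irr.
have u0 : u != 0 by apply: contraNneq f0 => u0; rewrite Df u0 mul0r.
have [||q [l [Pq ql Nql]]] := IH u _ u0.
- have k_gt0 : (0 < k)%N.
    by case: (k) Df => // Df; rewrite Df mulr1 (negPf Npu) in pf.
  suff: (1 < size (p ^+ k))%N.
    have := size_mul u0 (monic_neq0 (monic_exp k (proj2 (andP Pp)))).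
    by rewrite -Df; move: lefm f_gt1; move: (size f) (size u) (size (p ^+ k)); lia.
  rewrite -subn_gt0 subn1 size_exp muln_gt0 k_gt0 andbT.
  exact: (monic_irr_pdeg_gt0 Pp).
- by apply: contra Nfs => us; rewrite Df Gauss_dvdp // us.
by exists q, l; rewrite Df dvdp_mulr.
Qed.

Lemma coprimep_prod_monic_irr (s : seq {poly F}) p : monic_irr p ->
  all monic_irr s -> coprimep p (\prod_(q <- s) q) = (p \notin s).
Proof.
move=> Pp; elim: s => [|q s IH] /=; first by rewrite big_nil coprimep1.
case/andP=> Pq Ps; rewrite big_cons coprimepMr IH // inE negb_or.
by rewrite monic_irr_coprimep_neq.
Qed.

Lemma dvdp_prod_monic_irr (s : seq {poly F}) f : uniq s -> all monic_irr s ->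
  all (fun p => p %| f) s -> \prod_(p <- s) p %| f.
Proof.
elim: s => [|p s IH] /=; first by rewrite big_nil dvd1p.
case/andP=> Nps Us /andP [Pp Ps] /andP [pf sf].
by rewrite big_cons Gauss_dvdp ?pf ?IH ?coprimep_prod_monic_irr.
Qed.

Lemma monic_prod_monic_irr (s : seq {poly F}) :
  all monic_irr s -> \prod_(p <- s) p \is monic.
Proof.
by move/allP=> Ps; rewrite big_seq; apply: monic_prod => p /Ps /andP [].
Qed.

Lemma pdeg_prod_monic_irr (s : seq {poly F}) : all monic_irr s ->
  pdeg (\prod_(p <- s) p) = (\sum_(p <- s) pdeg p)%N.
Proof.
elim: s => [|p s IH] /=; first by rewrite !big_nil /pdeg size_poly1.
case/andP=> Pp Ps; rewrite !big_cons -IH //.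
exact: pdegM (monic_irr_neq0 Pp) (monic_neq0 (monic_prod_monic_irr Ps)).
Qed.

(** The quotient by [p] is a field with [#|F| ^ pdeg p] elements, so the class of ['X] is fixed by
    raising to that power. *)
Lemma monic_irr_dvd_Xq p : monic_irr p -> p %| 'X^(#|F| ^ pdeg p) - 'X.
Proof.
move=> Pp; have Pm : monic_irreducible_poly p.
  by case/andP: Pp => /irreducibleP.
pose K := {poly %/ p with Pm}.
have := expf_card (in_qpoly p 'X : K); rewrite card_qfpoly -/(pdeg p) => E.
have : in_qpoly p ('X^(#|F| ^ pdeg p) - 'X) = 0.
  by rewrite rmorphB rmorphXn /=; apply/eqP; rewrite subr_eq0; apply/eqP.
move/(congr1 val) => /=; rewrite mk_monicE // => /eqP E0.
by rewrite Pdiv.Idomain.dvdpE.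
Qed.

Lemma monic_irr_XsubC (c : F) : monic_irr ('X - c%:P).
Proof. by rewrite /monic_irr monicXsubC andbT; apply/irreducibleP/irredp_XsubC. Qed.

Lemma pdeg_XsubC (c : F) : pdeg ('X - c%:P) = 1%N.
Proof. by rewrite /pdeg size_XsubC. Qed.

Lemma expf_card_exp (c : F) d : c ^+ (#|F| ^ d) = c.
Proof. by elim: d => [|d IH]; rewrite ?expn0 ?expr1 // expnSr exprM IH expf_card. Qed.

(** The entries of [s] and all the ['X - c%:P] are distinct primes dividing ['X^(#|F| ^ d) - 'X];
    comparing degrees gives the bound, the linear factors contributing the term [#|F|]. *)
Lemma monic_irr_count d (s : seq {poly F}) : (1 < d)%N -> uniq s ->
  all monic_irr s -> all (fun p => pdeg p == d) s ->
  (d * size s + #|F| <= #|F| ^ d)%N.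
Proof.
move=> d_gt1 Us Ps /allP ds.
pose lin := [seq 'X - c%:P | c <- enum F]; pose f : {poly F} := 'X^(#|F| ^ d) - 'X.
have q_gt1 := card_finNzRing_gt1 F.
have N_gt1 : (1 < #|F| ^ d)%N by rewrite -{1}(expn0 #|F|) ltn_exp2l // ltnW.
have sf : size f = (#|F| ^ d).+1.
  by rewrite size_polyDl size_polyXn // size_polyN size_polyX.
have Pt : all monic_irr (lin ++ s).
  rewrite all_cat Ps andbT; apply/allP=> _ /mapP [c _ ->]; exact: monic_irr_XsubC.
have Ut : uniq (lin ++ s).
  rewrite cat_uniq Us andbT; apply/andP; split.
    rewrite map_inj_uniq ?enum_uniq // => a b.
    by move/addrI/oppr_inj/polyC_inj.
  apply/hasPn => p /ds /eqP dp; apply/negP=> /mapP [c _ Dp].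
  by rewrite Dp pdeg_XsubC in dp; rewrite -dp in d_gt1.
have /dvdp_leq : \prod_(p <- lin ++ s) p %| f.
  apply: dvdp_prod_monic_irr => //; rewrite all_cat; apply/andP; split.
    apply/allP=> _ /mapP [c _ ->].
    by rewrite dvdp_XsubCl rootE !hornerE expf_card_exp subrr.
  by apply/allP=> p ps; rewrite /f -(eqP (ds p ps)) monic_irr_dvd_Xq // (allP Ps).
rewrite -size_poly_eq0 sf => /(_ isT).
have Q0 := monic_neq0 (monic_prod_monic_irr Pt).
rewrite -[X in (X <= _)%N]prednK ?size_poly_gt0 // ltnS.
rewrite -/(pdeg _) pdeg_prod_monic_irr // big_cat /= big_map.
under eq_bigr do rewrite pdeg_XsubC.
rewrite sum1_size -cardE addnC big_seq; under eq_bigr => p ps do rewrite (eqP (ds p ps)).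
by rewrite -big_seq big_const_seq count_predT iter_addn_0.
Qed.

End MonicIrreducible.

Arguments monic_irr {F} p.

(** * Sieving congruences: Chinese remaindering and the union bound *)

Section Congruences.

Variable F : finFieldType.
Implicit Types (p q f g h r a b Q : {poly F}).

(* The triple [(p, k, r)] stands for the congruence [g = r] mod [p ^+ k]. *)
Definition congruence := ({poly F} * nat * {poly F})%type.
Implicit Types (c : congruence) (L : seq congruence).

Definition avoids g c := ~~ (c.1.1 ^+ c.1.2 %| g - c.2).

Lemma avoids_exp_gt0 g c : avoids g c -> (0 < c.1.2)%N.
Proof. by rewrite /avoids; case: c.1.2 => //; rewrite expr0 dvd1p. Qed.

Lemma missing_residue d (s : seq {poly F}) : (size s < #|F| ^ d)%N ->
  exists2 a : {poly F}, (size a <= d)%N & a \notin s.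
Proof.
move=> lts; pose t : seq {poly F} := map val (enum {poly_d F} : seq {poly_d F}).
have Ut : uniq t by rewrite map_inj_uniq ?enum_uniq //; apply: val_inj.
have [/allP ts|/allPn [a /mapP [h _ ->] Na]] := boolP (all (fun a => a \in s) t).
  by have := uniq_leq_size Ut ts; rewrite size_map -cardE card_npoly leqNgt lts.
by exists (val h) => //; apply: size_npoly.
Qed.

(* When [pdeg p > m] the exponent truncates to [0]: such a class contains at most
   one polynomial of degree less than [m]. *)
Lemma card_congruence_class m p Q b : p != 0 -> coprimep p Q ->
  (#|[set h : {poly_m F} | (p %| Q * val h + b)%R]| <= #|F| ^ (m - pdeg p))%N.
Proof.
move=> p0 cop; rewrite -card_npoly.
pose phi (h : {poly_m F}) := npolyp (m - pdeg p) (val h %/ p).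
have valphi (h : {poly_m F}) : val (phi h) = val h %/ p.
  by apply: npolypK; rewrite size_divp // leq_sub2r // size_npoly.
rewrite -(card_in_imset (f := phi)); first exact: max_card.
move=> h1 h2; rewrite !inE => d1 d2 /(congr1 val).
rewrite !valphi => Ediv; apply: val_inj.
have : p %| val h1 - val h2.
  rewrite -(Gauss_dvdpr _ cop).
  by have := dvdp_sub d1 d2; congr (_ %| _); ring.
rewrite /dvdp modpD modpN subr_eq0 => /eqP Emod.
by rewrite (divp_eq (val h1) p) Ediv Emod -divp_eq.
Qed.

Lemma union_bound m Q a L :
    all (fun c => monic_irr c.1.1 && coprimep c.1.1 Q) L ->
    (\sum_(c <- L) #|F| ^ (m - pdeg c.1.1) < #|F| ^ m)%N ->
  exists2 h : {poly F}, (size h <= m)%N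
    & all (fun c => ~~ (c.1.1 %| Q * h + a - c.2)) L.
Proof.
move=> PL; pose hit c (h : {poly_m F}) := c.1.1 %| Q * val h + (a - c.2).
have bnd : (#|[set h | has (hit^~ h) L]| <=
    \sum_(c <- L) #|F| ^ (m - pdeg c.1.1))%N.
  elim: L PL => [|c L IH] /=.
    by move=> _; rewrite big_nil leqn0 cards_eq0; apply/eqP/setP=> h; rewrite !inE.
  case/andP=> /andP [Pc cop] /IH {}IH; rewrite big_cons.
  have := card_congruence_class m (a - c.2) (monic_irr_neq0 Pc) cop.
  move/leq_add => /(_ _ _ IH); apply: leq_trans.
  apply: leq_trans (leq_card_setU _ _); apply/subset_leq_card/subsetP=> h.
  by rewrite !inE.
rewrite -card_npoly => /(leq_ltn_trans bnd); rewrite -cardsT => ltc.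
have /subsetPn [h _] : ~~ ([set: {poly_m F}] \subset [set h | has (hit^~ h) L]).
  by apply: contraL ltc => /subset_leq_card; rewrite -leqNgt.
rewrite inE -all_predC => /allP Nh; exists (val h); first exact: size_npoly.
by apply/allP=> c /Nh; rewrite /hit /= addrA.
Qed.

(** At each prime of [S] the forbidden residues are fewer than the residue classes, so one is free;
    the free residues are glued one prime at a time. *)
Lemma avoid_residues (S : seq {poly F}) L : uniq S -> all monic_irr S ->
    {in S, forall p, (count (fun c => c.1.1 == p) L < #|F| ^ pdeg p)%N} ->
  exists a, {in L, forall c, c.1.1 \in S -> ~~ (c.1.1 %| a - c.2)}.
Proof.
elim: S => [|p S IH] /=; first by move=> _ _ _; exists 0.
case/andP=> NpS US /andP [Pp PS] few.
have [|a aP] := IH US PS; first by move=> q qS; apply: few; rewrite inE qS orbT.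
pose Q := \prod_(q <- S) q.
have /Bezout_eq1_coprimepP [[u v] /= uv] : coprimep p Q.
  by rewrite coprimep_prod_monic_irr.
have [|b sb Nb] := @missing_residue (pdeg p)
    [seq c.2 %% p | c <- L & c.1.1 == p].
  by rewrite size_map size_filter few ?inE ?eqxx.
(* Since [u * p + v * Q = 1], this is [b] modulo [p] and still [a] modulo [Q]. *)
exists (a + v * Q * (b - a)) => c cL; rewrite inE; case: eqP => [cp _|Ncp /= cS].
  apply: contra Nb; rewrite cp => pdvd.
  suff: p %| b - c.2.
    rewrite /dvdp modpD modpN subr_eq0 => /eqP Eb.
    rewrite -(modp_small (_ : size b < size p)%N) ?Eb ?(size_monic_irr Pp) //.
    by apply/mapP; exists c => //; rewrite mem_filter cp eqxx.
  have Eba : b - a = (u * p + v * Q) * (b - a) by rewrite uv mul1r.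
  rewrite [X in p %| X](_ : _ = (a + v * Q * (b - a) - c.2) + p * (u * (b - a))).
    by rewrite dvdp_add // dvdp_mulr.
  by transitivity (b - a + (a - c.2)); [ring | rewrite {1}Eba; ring].
have cQ : c.1.1 %| Q by rewrite /Q (big_rem _ cS) /= dvdp_mulr.
rewrite (_ : _ - _ = (a - c.2) + v * (b - a) * Q); last by ring.
by rewrite dvdp_addl ?aP // dvdp_mull.
Qed.

Lemma size_mod_class Q h a n : Q != 0 ->
  (size h + pdeg Q <= n)%N -> (size a <= pdeg Q)%N -> (size (Q * h + a)%R <= n)%N.
Proof.
move=> Q0 sh sa; apply: leq_trans (size_polyD _ _) _; rewrite geq_max.
apply/andP; split; last by rewrite (leq_trans sa) // (leq_trans _ sh) ?leq_addl.
apply: leq_trans (size_polyMleq _ _) _; apply: leq_trans sh.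
have := Q0; rewrite /pdeg -size_poly_gt0; move: (size Q) (size h); lia.
Qed.

(** A class modulo [Q], the product of [S], disposes of the congruences at [S]; the union bound over
    [h] in [Q * h + a %% Q] disposes of the others. Each prime power is replaced by its prime, which
    only makes avoidance harder. *)
Lemma sieve n (S : seq {poly F}) L (m := (\sum_(p <- S) pdeg p)%N) :
    uniq S -> all monic_irr S ->
    {in S, forall p, (count (fun c => c.1.1 == p) L < #|F| ^ pdeg p)%N} ->
    all (fun c => monic_irr c.1.1 && (0 < c.1.2)%N) L -> (m <= n)%N ->
    (\sum_(c <- L | c.1.1 \notin S) #|F| ^ (n - m - pdeg c.1.1)
       < #|F| ^ (n - m))%N ->
  exists2 g : {poly F}, (size g <= n)%N & all (avoids g) L.
Proof.
move=> US PS few /allP PL lemn; pose Q := \prod_(p <- S) p.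
have degQ : pdeg Q = m by rewrite pdeg_prod_monic_irr.
have Q0 : Q != 0 by rewrite monic_neq0 ?monic_prod_monic_irr.
have [a aP] := avoid_residues US PS few.
rewrite -big_filter => lt_sum.
have [|h sh /allP hP] := union_bound (Q := Q) (a %% Q) _ lt_sum.
  apply/allP=> c; rewrite mem_filter => /andP [cS /PL /andP [Pc _]].
  by rewrite Pc coprimep_prod_monic_irr.
exists (Q * h + a %% Q).
  apply: size_mod_class; rewrite ?degQ //; first by rewrite addnC -leq_subRL.
  by rewrite -ltnS -degQ /pdeg prednK ?size_poly_gt0 // ltn_modp.
apply/allP=> c cL; have /andP [Pc k_gt0] := PL c cL.
rewrite /avoids; apply: contra (_ : ~~ (c.1.1 %| Q * h + a %% Q - c.2)) => [|].
  by apply: dvdp_trans; rewrite -{1}(expr1 c.1.1) dvdp_exp2l.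
have [cS|cS] := boolP (c.1.1 \in S); last by apply: hP; rewrite mem_filter cS.
apply: contra (aP c cL cS) => cdvd.
have cQ : c.1.1 %| Q by rewrite /Q (big_rem _ cS) /= dvdp_mulr.
rewrite {1}(divp_eq a Q).
suff -> : a %/ Q * Q + a %% Q - c.2
    = (Q * h + a %% Q - c.2) + (a %/ Q - h) * Q by rewrite dvdp_add // dvdp_mull.
by ring.
Qed.

End Congruences.

(** * Two-element field: the case of few congruences at every prime *)

Lemma count_mem_image_le (T : Type) (I : eqType) (f : T -> I) (s : seq I)
    (L : seq T) b :
  {in s, forall i, (count (fun x => f x == i) L <= b)%N} ->
  (count (fun x => f x \in s) L <= b * size s)%N.
Proof.
elim: s => [|i s IH] few; first by rewrite (eq_count (a2 := pred0)) ?count_pred0.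
have {}IH : (count (fun x => f x \in s) L <= b * size s)%N.
  by apply: IH => j js; apply: few; rewrite inE js orbT.
have := few i (mem_head i s); rewrite /= mulnS => lei.
apply: leq_trans (leq_add lei IH); rewrite -count_predUI.
apply: leq_trans (leq_addr _ _); apply: sub_count => x.
by rewrite /= inE.
Qed.

Section Binary.

Variable F : finFieldType.
Hypothesis card2 : #|F| = 2.
Implicit Types (p q f g h r a b Q : {poly F}).
Implicit Types (c : congruence F) (L : seq (congruence F)).

(** Induction on [D]: the primes of degree [D] add at most [2 ^ D - 2] to the earlier
    [2 ^ D - 2 * D], which gives exactly [2 ^ D.+1 - 2 * D.+1]. *)
Lemma monic_irr_total_degree D (s : seq {poly F}) : (1 < D)%N -> uniq s ->
    all monic_irr s -> all (fun p => 1 < pdeg p < D)%N s ->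
  (\sum_(p <- s) pdeg p + 2 * D <= 2 ^ D)%N.
Proof.
elim: D s => // D IH s; rewrite ltnS leq_eqVlt => /predU1P [<-|D_gt1] Us Ps ds.
  by case: s ds {Us Ps} => [|p s] /=; [rewrite big_nil | lia].
rewrite (bigID (fun p => pdeg p == D)) /=.
rewrite -[X in (X + _ + _)%N]big_filter -[X in (_ + X + _)%N]big_filter.
set s1 := filter _ s; set s2 := filter _ s.
have all1 : all (fun p => pdeg p == D) s1 by apply: filter_all.
have := monic_irr_count D_gt1 (filter_uniq _ Us : uniq s1).
rewrite card2 => /(_ _ all1) H1.
have {}H1 : (D * size s1 + 2 <= 2 ^ D)%N.
  by apply: H1; rewrite all_filter; apply: sub_all Ps => p Pp; apply/implyP.
have H2 : (\sum_(p <- s2) pdeg p + 2 * D <= 2 ^ D)%N.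
  apply: IH; rewrite ?filter_uniq ?all_filter //.
    by apply: sub_all Ps => p Pp; apply/implyP.
  by apply: sub_all ds => p dp; apply/implyP; lia.
have -> : (\sum_(p <- s1) pdeg p = D * size s1)%N.
  rewrite big_seq; under eq_bigr => p ps do rewrite (eqP (allP all1 p ps)).
  by rewrite -big_seq big_const_seq count_predT iter_addn_0.
by rewrite expnS; lia.
Qed.

Lemma few_congruences_per_prime n L : (size L <= n)%N ->
    all (fun c => monic_irr c.1.1 && (0 < c.1.2)%N) L ->
    (forall p, monic_irr p -> (count (fun c => c.1.1 == p) L < pdeg p)%N) ->
  exists2 g : {poly F}, (size g <= n)%N & all (avoids g) L.
Proof.
move=> sL PL few.
have PL' c : c \in L -> monic_irr c.1.1 by case/(allP PL)/andP.
have deg_gt1 c : c \in L -> (1 < pdeg c.1.1)%N.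
  (* A prime that occurs carries at least one congruence and fewer than its degree. *)
  move=> cL; apply: leq_trans (few _ (PL' c cL)); rewrite ltnS -has_count.
  by apply/hasP; exists c => /=.
have lt2 p : (pdeg p < #|F| ^ pdeg p)%N by rewrite card2 ltn_expl.
(* With [S] empty the union bound needs [n * 2 ^ (n - 2) < 2 ^ n], which holds up to [n = 3] and
   becomes an equality at [4]. *)
have [n_lt4|n_ge4] := ltnP n 4.
  apply: (@sieve F n [::]); rewrite // big_nil // subn0 card2.
  apply: (@leq_ltn_trans (size L * 2 ^ (n - 2))).
    rewrite -sum1_size big_distrl /= (eq_bigl xpredT) // big_seq [leqRHS]big_seq.
    apply: leq_sum => c cL; rewrite mul1n leq_exp2l // leq_sub2l //.
    exact: deg_gt1.
  apply: leq_ltn_trans (leq_mul sL (leqnn _)) _.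
  by move: n n_lt4 {sL} => [|[|[|[|]]]].
pose D := trunc_log 2 n.
have n_gt0 : (0 < n)%N by apply: leq_trans n_ge4.
have leDn : (2 ^ D <= n)%N by apply: trunc_logP.
have ltnD : (n < 2 ^ D.+1)%N by apply: trunc_log_ltn.
have D_gt1 : (1 < D)%N by rewrite -ltnS -(ltn_exp2l _ _ (leqnn 2)) (leq_ltn_trans n_ge4).
pose P := undup [seq c.1.1 | c <- L].
have irrP p : p \in P -> monic_irr p.
  by rewrite mem_undup => /mapP [c cL ->]; apply: PL'.
have inP c : c \in L -> c.1.1 \in P.
  by move=> cL; rewrite mem_undup; apply/mapP; exists c.
pose A := [seq p <- P | pdeg p < D]%N; pose B := [seq p <- P | pdeg p == D].
(* [j] is [t / D] rounded up: the primes taken from [B] must offset the excess [t] of [n] over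
   [2 ^ D]. *)
pose t := (n - 2 ^ D)%N; pose j := ((t + D.-1) %/ D)%N.
pose S := A ++ take j B.
have UP : uniq P by apply: undup_uniq.
have UB : uniq B by apply: filter_uniq.
have US : uniq S.
  rewrite cat_uniq filter_uniq // take_uniq // andbT.
  apply/hasPn => p /mem_take; rewrite !mem_filter => /andP [/eqP -> _].
  by rewrite ltnn.
have PS : all monic_irr S.
  apply/allP=> p; rewrite mem_cat => /orP [|/mem_take];
  by rewrite mem_filter => /andP [_ /irrP].
have degB : all (fun p => pdeg p == D) B by apply: filter_all.
have sB : (D * size B + 2 <= 2 ^ D)%N.
  have := monic_irr_count D_gt1 UB; rewrite card2; apply=> //.
  by apply/allP=> p; rewrite mem_filter => /andP [_ /irrP].
have sA : (\sum_(p <- A) pdeg p + 2 * D <= 2 ^ D)%N.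
  apply: monic_irr_total_degree; rewrite ?filter_uniq //.
    by apply/allP=> p; rewrite mem_filter => /andP [_ /irrP].
  apply/allP=> p; rewrite mem_filter => /andP [-> pP]; rewrite andbT.
  by move: pP; rewrite mem_undup => /mapP [c cL ->]; apply: deg_gt1.
have jD : (t <= j * D <= t + D.-1)%N.
  have := divn_eq (t + D.-1) D; have := ltn_pmod (t + D.-1) (ltnW D_gt1).
  by rewrite -/j; lia.
pose m := (\sum_(p <- S) pdeg p)%N.
have mE : (m <= \sum_(p <- A) pdeg p + j * D)%N.
  rewrite /m big_cat leq_add2l big_seq.
  under eq_bigr => p ps do rewrite (eqP (allP degB p (mem_take ps))).
  rewrite -big_seq big_const_seq count_predT iter_addn_0 mulnC leq_mul2r.
  by rewrite size_take_min geq_minl orbT.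
(* Indeed [m] is at most [(2 ^ D - 2 * D) + (t + D.-1) = n - D.+1], so the exponent [n - m - D.+1]
   used below is not truncated. *)
have ltm : (m + D.+1 <= n)%N by rewrite /t in jD; lia.
have count_drop : (count (fun c => c.1.1 \in drop j B) L <= D.-1 * (size B - j))%N.
  rewrite -size_drop; apply: count_mem_image_le => p /mem_drop.
  rewrite mem_filter => /andP [/eqP pD /irrP /few].
  by rewrite pD; lia.
(* If [j] is less than [size B], the second count is at most [2 ^ D - 2 - t], and [n = 2 ^ D + t];
   otherwise it is zero. *)
have total : (size L + count (fun c => c.1.1 \in drop j B) L < 2 ^ D.+1)%N.
  move: count_drop; set N := count _ _; move: N => N leN.
  have {}leN : (N <= D * (size B - j))%N.
    by apply: leq_trans leN _; rewrite leq_mul2r leq_pred orbT.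
  rewrite expnS in ltnD *; rewrite mulnBr in leN; rewrite /t mulnC in jD; lia.
apply: (@sieve F n S) => //.
- by move=> p /(allP PS) Pp; apply: leq_ltn_trans (lt2 p); apply: ltnW; apply: few.
- by rewrite -/m; lia.
rewrite -/m card2.
(* In units of [2 ^ (n - m - D.+1)], a prime of degree above [D] weighs at most one and a dropped
   prime of degree [D] weighs two, hence the second count. *)
apply: (@leq_ltn_trans (2 ^ (n - m - D.+1) *
    (size L + count (fun c => c.1.1 \in drop j B) L))); last first.
  rewrite -[ltnRHS](_ : 2 ^ (n - m - D.+1) * 2 ^ D.+1 = _)%N ?ltn_pmul2l ?expn_gt0 //.
  by rewrite -expnD; congr (2 ^ _)%N; lia.
rewrite -sum1_count -sum1_size [X in (_ * (_ + X))%N]big_mkcond -big_split /= big_distrr /=.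
rewrite big_seq_cond [leqRHS]big_seq [leqRHS](bigID (fun c => c.1.1 \notin S)) /=.
apply: leq_trans (leq_addr _ _); apply: leq_sum => c /andP [cL].
rewrite mem_cat negb_or mem_filter inP // andbT -leqNgt => /andP [leD Nt].
move: leD; rewrite leq_eqVlt => /predU1P [ED|ltD].
  have cB : c.1.1 \in B by rewrite mem_filter -ED eqxx inP.
  have -> : c.1.1 \in drop j B.
    by move: cB; rewrite -{1}(cat_take_drop j B) mem_cat (negPf Nt).
  by rewrite -ED -expnSr leq_exp2l // subnS leqSpred.
apply: leq_trans (leq_pmulr _ _) => //.
by rewrite leq_exp2l // leq_sub2l.
Qed.

End Binary.

(** * Restriction to a residue class modulo a prime, and the main induction *)

Section Restriction.

Variable F : finFieldType.
Implicit Types (p q f g h r a b Q : {poly F}).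
Implicit Types (c : congruence F) (L : seq (congruence F)).

Definition disjoint_from_class p a c := (c.1.1 == p) && ~~ (p %| a - c.2).

Lemma disjoint_avoids p a c h : (0 < c.1.2)%N -> disjoint_from_class p a c ->
  avoids (p * h + a) c.
Proof.
move=> k_gt0 /andP [/eqP cp Npa]; apply: contra Npa => /= dvd.
have : p %| p * h + a - c.2.
  by apply: dvdp_trans dvd; rewrite cp -{1}(expr1 p) dvdp_exp2l.
by rewrite -addrA dvdp_addr // dvdp_mulr.
Qed.

(** At the prime [p] itself one factor [p] cancels and the exponent drops by one, possibly to zero,
    so positivity is not asserted of [c']. At another prime [p] is invertible, and [u * (r - a)]
    solves for [h]. *)
Lemma restrict_congruence p a c : monic_irr p -> monic_irr c.1.1 ->
    (0 < c.1.2)%N -> ~~ disjoint_from_class p a c ->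
  exists2 c', monic_irr c'.1.1 & forall h, avoids (p * h + a) c = avoids h c'.
Proof.
case: c => [[q k] r] /= Pp Pq k_gt0; rewrite /disjoint_from_class /= => Nd.
have [Eqp|Nqp] := eqVneq q p.
  move: Nd; rewrite {}Eqp eqxx /= negbK => pdvd.
  case: k k_gt0 => // k _; exists (p, k, - ((a - r) %/ p)) => // h.
  rewrite /avoids /= opprK; congr (~~ _).
  rewrite (_ : p * h + a - r = p * (h + (a - r) %/ p)).
    by rewrite exprS dvdp_mul2l // monic_irr_neq0.
  by rewrite mulrDr [p * (_ %/ _)]mulrC divpK // addrA.
have cop : coprimep (q ^+ k) p.
  by apply: coprimep_expl; rewrite monic_irr_coprimep_neq.
have /Bezout_eq1_coprimepP [[v u] /= uv] := cop.
exists (q, k, u * (r - a)) => // h; rewrite /avoids /=; congr (~~ _).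
rewrite -(Gauss_dvdpr (h - u * (r - a)) cop).
have -> : p * h + a - r
    = p * (h - u * (r - a)) - v * (r - a) * q ^+ k.
  transitivity (p * h - 1 * (r - a)); first by rewrite mul1r; ring.
  by rewrite -uv; ring.
by rewrite dvdp_addl // dvdpNr dvdp_mull.
Qed.

Lemma restrict_congruences p a L : monic_irr p ->
    all (fun c => monic_irr c.1.1 && (0 < c.1.2)%N) L ->
  exists L', [/\ (size L' + count (disjoint_from_class p a) L = size L)%N,
    all (fun c => monic_irr c.1.1) L'
    & forall h, all (avoids (p * h + a)) L = all (avoids h) L'].
Proof.
move=> Pp; elim: L => [|c L IH] /=; first by exists [::].
case/andP=> /andP [Pc k_gt0] /IH [L' [sL' PL' avL']].
have [dc|Nc] := boolP (disjoint_from_class p a c).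
  exists L'; split=> //; first by lia.
  by move=> h; rewrite disjoint_avoids // avL'.
have [c' Pc' avc'] := restrict_congruence Pp Pc k_gt0 Nc.
exists (c' :: L'); split=> /=; first by lia.
  by rewrite Pc'.
by move=> h; rewrite avc' avL'.
Qed.

(** Chinese remaindering: a polynomial equal to [b] modulo [p] and to [g] modulo the remaining prime
    powers avoids everything. *)
Lemma class_meets_uncovered p b L g : monic_irr p ->
    all (fun c => monic_irr c.1.1) L -> all (avoids g) L ->
    {in L, forall c, c.1.1 = p -> ~~ (p %| b - c.2)} ->
  exists h, all (avoids (p * h + b)) L.
Proof.
move=> Pp /allP PL /allP gL Nb.
pose M := \prod_(c <- L | c.1.1 != p) c.1.1 ^+ c.1.2.
have cop : coprimep p M.
  rewrite /M big_seq_cond; elim/big_ind: _ => [|x y cx cy|c /andP [cL Ncp]].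
  - exact: coprimep1.
  - by rewrite coprimepMr cx.
  - by apply: coprimep_expr; rewrite monic_irr_coprimep_neq ?PL // eq_sym.
have /Bezout_eq1_coprimepP [[u v] /= uv] := cop.
exists (u * (g - b)); apply/allP=> c cL.
have [cp|Ncp] := eqVneq c.1.1 p.
  apply: disjoint_avoids; first exact: avoids_exp_gt0 (gL c cL).
  by rewrite /disjoint_from_class cp eqxx Nb.
apply: contra (gL c cL) => dvd.
have dvdM : c.1.1 ^+ c.1.2 %| M.
  by rewrite /M (big_rem c) //= Ncp dvdp_mulr.
rewrite (_ : g - c.2 = (p * (u * (g - b)) + b - c.2) + v * (g - b) * M).
  by rewrite dvdp_add // dvdp_mull.
transitivity (1 * (g - b) + (b - c.2)); first by rewrite mul1r; ring.
by rewrite -uv; ring.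
Qed.

Lemma disjoint_class_exists p L g : monic_irr p ->
    all (fun c => monic_irr c.1.1) L -> all (avoids g) L ->
    (pdeg p <= count (fun c => c.1.1 == p) L)%N ->
  exists a h, [/\ (size a <= pdeg p)%N, all (avoids (p * h + a)) L
    & (pdeg p <= count (disjoint_from_class p a) L)%N].
Proof.
move=> Pp PL gL many; have sp := size_monic_irr Pp.
have p0 := monic_irr_neq0 Pp.
have modp_dvd b c : (p %| b - c.2) = (b %% p == c.2 %% p).
  by rewrite /dvdp modpD modpN subr_eq0.
pose a := g %% p.
have sa : (size a <= pdeg p)%N by rewrite -ltnS -sp ltn_modp.
have [le_d|lt_d] := leqP (pdeg p) (count (disjoint_from_class p a) L).
  by exists a, (g %/ p); rewrite mulrC -divp_eq.
(* Fewer than [pdeg p] congruences at [p] have a residue other than [a]; with [a] itself this makes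
   at most [pdeg p] residues, so some [b] is free and every congruence at [p] is disjoint from its
   class. *)
have [|b sb Nb] := @missing_residue F (pdeg p)
    (a :: [seq c.2 %% p | c <- L & disjoint_from_class p a c]).
  rewrite /= size_map size_filter; apply: leq_ltn_trans lt_d _.
  by rewrite ltn_expl // card_finNzRing_gt1.
have Nbc : {in L, forall c, c.1.1 = p -> ~~ (p %| b - c.2)}.
  move=> c cL cp; rewrite modp_dvd modp_small ?sp //.
  apply: contra Nb => /eqP ->; rewrite inE.
  have [dc|] := boolP (disjoint_from_class p a c).
    by apply/orP; right; apply/mapP; exists c; rewrite // mem_filter dc.
  rewrite /disjoint_from_class cp eqxx /= negbK modp_dvd modp_small ?sp //.
  by rewrite eq_sym => ->.
have [h hL] := class_meets_uncovered Pp PL gL Nbc.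
exists b, h; split=> //; apply: leq_trans many _.
rewrite -!size_filter; rewrite (eq_in_filter (a2 := disjoint_from_class p b)) //.
move=> c cL; rewrite /disjoint_from_class; case: eqP => //= cp.
by rewrite Nbc.
Qed.

Theorem prime_power_avoidance n L : #|F| = 2 -> (size L <= n)%N ->
    all (fun c => monic_irr c.1.1) L -> (exists g, all (avoids g) L) ->
  exists2 g : {poly F}, (size g <= n)%N & all (avoids g) L.
Proof.
move=> card2; elim/ltn_ind: n L => n IH L sL PL [g gL].
(* Restriction may create zero exponents, but a congruence modulo [1] would exclude the missed
   [g]. *)
have PkL : all (fun c => monic_irr c.1.1 && (0 < c.1.2)%N) L.
  apply/allP=> c cL; rewrite (allP PL) //=.
  exact: avoids_exp_gt0 (allP gL c cL).
pose many c := (pdeg c.1.1 <= count (fun c' => c'.1.1 == c.1.1) L)%N.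
have [/hasP [c cL cmany]|/hasPn few] := boolP (has many L); last first.
  apply: few_congruences_per_prime => // p Pp.
  have [/hasP [c cL /eqP cp]|] := boolP (has (fun c => c.1.1 == p) L).
    by have := few c cL; rewrite /many -ltnNge cp.
  by rewrite has_count -leqNgt leqn0 => /eqP ->; apply: monic_irr_pdeg_gt0.
have Pp : monic_irr c.1.1 := allP PL c cL.
have d_gt0 := monic_irr_pdeg_gt0 Pp.
have [a [h [sa hL le_d]]] := disjoint_class_exists Pp PL gL cmany.
have [L' [sL' PL' avL']] := restrict_congruences a Pp PkL.
have dn : (pdeg c.1.1 <= n)%N.
  exact: leq_trans cmany (leq_trans (count_size _ _) sL).
have [|||h0 sh0 h0L'] := IH (n - pdeg c.1.1)%N _ L' _ PL'.
- by rewrite ltn_subrL d_gt0 (leq_trans d_gt0).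
- by lia.
- by exists h; rewrite -avL'.
exists (c.1.1 * h0 + a); last by rewrite avL'.
apply: size_mod_class => //; first exact: monic_irr_neq0.
by rewrite addnC -leq_subRL.
Qed.

End Restriction.

(** * From arbitrary moduli to prime powers *)

Lemma not_bad n : ~ bad n.
Proof.
case=> n_gt0 [f [r [deg_lt [g gP] cover]]].
have f0 i : f i != 0.
  by apply: contraTneq (deg_lt i) => ->; rewrite /pdeg size_poly0.
have [L [sL PL gL avL]] : exists L : seq (congruence 'F_2),
    [/\ size L = n, all (fun c => monic_irr c.1.1) L, all (avoids g) L
      & forall g0, all (avoids g0) L -> forall i, ~~ (f i %| g0 - r i)].
  suff [L [sL PL gL avL]] : exists L : seq (congruence 'F_2),
    [/\ size L = size (enum 'I_n), all (fun c => monic_irr c.1.1) L,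
        all (avoids g) L & forall g0, all (avoids g0) L ->
        forall i, i \in enum 'I_n -> ~~ (f i %| g0 - r i)].
    exists L; rewrite sL size_enum_ord; split=> // g0 g0L i.
    by apply: avL; rewrite // mem_enum.
  (* One separating prime power is collected per index; avoiding it is stronger than avoiding the
     original congruence. *)
  elim: (enum 'I_n) => [|i s [L [sL PL gL avL]]]; first by exists [::].
  have /negP Nfi := gP i.
  have [p [k [Pp pkf Npk]]] := prime_power_separates (f0 i) Nfi.
  exists ((p, k, r i) :: L); split=> /=; rewrite ?sL ?Pp ?gL ?andbT //.
  move=> g0 /andP [av0 /avL {}avL] i'; rewrite inE => /predU1P [->|/avL //].
  by apply: contra av0; apply: dvdp_trans.
have [g0 sg0 /avL Ng0] :
    exists2 g0 : {poly 'F_2}, (size g0 <= n)%N & all (avoids g0) L.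
  by apply: prime_power_avoidance; rewrite ?card_Fp ?sL //; exists g.
have [i] : exists i, pcong g0 (r i) (f i).
  (* For [g0 = 0] the degree is zero by convention, and positivity of [n] is what applies. *)
  by apply: cover; rewrite /pdeg; case: (size g0) sg0 => [|k].
by apply/negP/Ng0.
Qed.

Theorem theorem2 :
  (exists n : nat, bad n) -> exists n : nat, (n < 10)%N /\ bad n.
Proof. by case=> n /not_bad. Qed.
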